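(* Let $(W,B)$ be a spherical latin bitrade and let $\mathcal{A}^*$, $\mathcal{B}^*$ be the abelian groups defined in the context. Then $|\mathcal{A}^*|=|\mathcal{B}^*|$.
   Context: A latin bitrade is a pair $(W,B)$ of non-empty finite sets of triples (row, column, symbol), any two distinct triples in the same set agreeing in at most one coordinate, such that for each $(r,c,s)\in W$ (resp. $B$) there exist unique $r'\ne r$, $c'\ne c$, $s'\ne s$ with $(r',c,s),(r,c',s),(r,c,s')\in B$ (resp. $W$). It is connected if it is not the union of two latin bitrades $(W',B')$, $(W'',B'')$ with $W'\cap W''=\emptyset$. With $R,C,S$ the pairwise disjoint sets of rows, columns, symbols used: for each row $r$ let $\psi_r(s)=s'$ iff $(r,c,s)\in W$, $(r,c,s')\in B$ for some $c$, with analogous permutations for columns and symbols; the bitrade is separated if all are single cycles. It is spherical if separated, connected and $2+|W|-|R|-|C|-|S|=0$ (then $(B,W)$ is also spherical). Let $\mathcal{V}=R\cup C\cup S$ be commuting indeterminates. Fix $(r_0,c_0,s_0)\in W$ and $(r_1,c_1,s_1)\in B$. Define $\mathcal{A}^*=\langle \mathcal{V}\mid r+c+s=0 \text{ for all }(r,c,s)\in W;\ r_0=c_0=s_0=0\rangle$ and $\mathcal{B}^*=\langle \mathcal{V}\mid r+c+s=0 \text{ for all }(r,c,s)\in B;\ r_1=c_1=s_1=0\rangle$, both abelian. *)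

(* Defs.v *)
From HB Require Import structures.
From mathcomp Require Import all_boot all_order all_algebra.
From mathcomp Require Import boolp classical_sets functions cardinality.

Set Implicit Arguments.
Unset Strict Implicit.
Unset Printing Implicit Defensive.

Import GRing.Theory.
Local Open Scope ring_scope.

Section PresentedAbelianGroup.
Variable X : finType.

(* {ffun X -> int} is the free abelian group on X; subgroup membership is not
   a priori decidable, hence the classical reflection. *)
Definition relspan (rels : seq {ffun X -> int}) : {pred {ffun X -> int}} :=
  fun x => `[< inIntSpan (in_tuple rels) x >].

Lemma relspan_zmod_closed (rels : seq {ffun X -> int}) :
  zmod_closed (relspan rels).
Proof.
split=> [|_ _ /asboolP[a ->] /asboolP[b ->]]; apply/asboolP.
  exists [ffun=> 0]; rewrite big1 // => i _; by rewrite ffunE mulr0z.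
exists [ffun i => a i - b i]; rewrite -sumrB; apply: eq_bigr => i _.
by rewrite ffunE mulrzBr.
Qed.

HB.instance Definition _ (rels : seq {ffun X -> int}) :=
  GRing.isZmodClosed.Build _ (relspan rels) (relspan_zmod_closed rels).

Definition presented_ab (rels : seq {ffun X -> int}) : zmodType :=
  Quotient.quot (relspan rels).

End PresentedAbelianGroup.

(* When e is the graph of a permutation of its domain, that permutation
   consists of exactly one cycle. *)
Definition single_cycle (T : finType) (e : rel T) : Prop :=
  exists2 p : seq T, ucycle e p & forall x, (x \in p) = [exists y, e x y].

Section LatinBitrade.
Variables R C S : finType.
Implicit Types (W B T : {set R * C * S}) (t : R * C * S).

Definition row_of t : R := t.1.1.
Definition col_of t : C := t.1.2.
Definition sym_of t : S := t.2.

Definition partial_latin T : Prop :=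
  forall t u, t \in T -> u \in T -> t <> u ->
    ((row_of t == row_of u) + (col_of t == col_of u)
       + (sym_of t == sym_of u) <= 1)%N.

Definition has_mates W B : Prop :=
  forall r c s, (r, c, s) \in W ->
    [/\ exists! r', r' <> r /\ (r', c, s) \in B,
        exists! c', c' <> c /\ (r, c', s) \in B &
        exists! s', s' <> s /\ (r, c, s') \in B].

Definition latin_bitrade W B : Prop :=
  [/\ W <> finset.set0 /\ B <> finset.set0, partial_latin W, partial_latin B,
      has_mates W B & has_mates B W].

Definition bitrade_connected W B : Prop :=
  ~ exists W' B' W'' B'',
      [/\ latin_bitrade W' B', latin_bitrade W'' B'',
          W = W' :|: W'', B = B' :|: B'' & W' :&: W'' = finset.set0].

Definition psi_row W B (r : R) : rel S :=
  fun s s' => [exists c, ((r, c, s) \in W) && ((r, c, s') \in B)].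
Definition psi_col W B (c : C) : rel R :=
  fun r r' => [exists s, ((r, c, s) \in W) && ((r', c, s) \in B)].
Definition psi_sym W B (s : S) : rel C :=
  fun c c' => [exists r, ((r, c, s) \in W) && ((r, c', s) \in B)].

(* The ambient types may contain elements that no triple uses. *)
Definition rows W B : {set R} := row_of @: (W :|: B).
Definition cols W B : {set C} := col_of @: (W :|: B).
Definition syms W B : {set S} := sym_of @: (W :|: B).

Definition bitrade_separated W B : Prop :=
  [/\ forall r, r \in rows W B -> single_cycle (psi_row W B r),
      forall c, c \in cols W B -> single_cycle (psi_col W B c) &
      forall s, s \in syms W B -> single_cycle (psi_sym W B s)].

Definition spherical_bitrade W B : Prop :=
  [/\ latin_bitrade W B, bitrade_separated W B, bitrade_connected W B &
      2 + #|W|%:Z - #|rows W B|%:Z - #|cols W B|%:Z - #|syms W B|%:Z = 0].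

(* The disjoint union of the rows, columns and symbols in use. *)
Definition indet W B : finType :=
  ({r | r \in rows W B} + {c | c \in cols W B} + {s | s \in syms W B})%type.

(* The generators attached to a row, column and symbol, as elements of the free
   abelian group; only meaningful for those in use (0 otherwise). *)
Definition row_gen W B (r : R) : {ffun indet W B -> int} :=
  [ffun v => if v is inl (inl r') then (val r' == r)%:Z else 0].
Definition col_gen W B (c : C) : {ffun indet W B -> int} :=
  [ffun v => if v is inl (inr c') then (val c' == c)%:Z else 0].
Definition sym_gen W B (s : S) : {ffun indet W B -> int} :=
  [ffun v => if v is inr s' then (val s' == s)%:Z else 0].

Definition triple_relators W B T : seq {ffun indet W B -> int} :=
  [seq row_gen W B (row_of t) + col_gen W B (col_of t) + sym_gen W B (sym_of t)
  | t <- enum T].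

Definition base_relators W B t : seq {ffun indet W B -> int} :=
  [:: row_gen W B (row_of t); col_gen W B (col_of t); sym_gen W B (sym_of t)].

Definition Astar W B t0 : zmodType :=
  presented_ab (triple_relators W B W ++ base_relators W B t0).

Definition Bstar W B t1 : zmodType :=
  presented_ab (triple_relators W B B ++ base_relators W B t1).

End LatinBitrade.

(* Main.v *)
(** Let N_W and N_B be the 0/1 incidence matrices of triples against
    indeterminates. Any two indeterminates, equal or not, lie together in
    as many triples of W as of B, so N_W^T N_W = N_B^T N_B. Adjoin to both
    matrices the unit rows of one row r and one column c: the Gram matrices still
    agree, and by Euler's formula the matrices are now square, so their
    determinants agree up to sign. By the Smith normal form the absolute value of
    the determinant gives the cardinality of the cokernel (countably infinite if
    it is 0). Finally the cokernel does not depend on the base point, because a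
    transvection fixing every triple relator carries one base point to another. *)

Require Import Defs.
From HB Require Import structures.
From mathcomp Require Import all_boot all_order all_algebra.
From mathcomp Require Import generic_quotient ring_quotient zify.
From mathcomp Require Import boolp classical_sets functions cardinality.

Set Implicit Arguments.
Unset Strict Implicit.
Unset Printing Implicit Defensive.

Import Order.TTheory GRing.Theory Num.Theory.
Local Open Scope quotient_scope.
Local Open Scope card_scope.
Local Open Scope ring_scope.

Lemma card_eq_setT_ord (T : finType) : [set: T]%classic #= `I_(#|T|).
Proof.
rewrite card_eq_sym.
have -> : `I_(#|T|) = ((fun x : T => nat_of_ord (enum_rank x)) @` setT)%classic.
  apply/seteqP; split=> [k /= ltk | _ [x _ <-] /=]; last exact: ltn_ord.
  by exists (enum_val (Ordinal ltk)) => //; rewrite enum_valK.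
by apply: inj_card_eq => x y _ _ /val_inj /enum_rank_inj.
Qed.

Lemma absz_det_unitmx n (A : 'M[int]_n) : A \in unitmx -> absz (\det A) = 1%N.
Proof.
move=> uA; have /(congr1 (absz \o determinant)) := mulmxV uA.
by rewrite /= det_mulmx det1 abszM => /eqP; rewrite muln_eq1 => /andP[/eqP].
Qed.

Lemma absz_prod (I : finType) (F : I -> int) :
  absz (\prod_i F i) = (\prod_i absz (F i))%N.
Proof. exact: (big_morph absz abszM). Qed.

(** * Counting vectors of residues *)

Section Residues.
Variables (n : nat) (d : 'I_n -> int).

(* As [x %% 0 = x], a coordinate with [d i = 0] is unconstrained. *)
Definition residues : set {ffun 'I_n -> int} :=
  [set x | forall i, (x i %% d i)%Z = x i]%classic.

Lemma card_residues_finite :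
  (forall i, d i != 0) -> residues #= `I_(\prod_i absz (d i))%N.
Proof.
move=> nz_d; pose T := {dffun forall i : 'I_n, 'I_(absz (d i))}.
have cardT : #|T| = (\prod_i absz (d i))%N.
  rewrite card_dep_ffun foldrE big_map big_enum /=.
  by apply: eq_bigr => i _; rewrite card_ord.
pose g (x : T) : {ffun 'I_n -> int} := [ffun i => Posz (x i)].
have -> : residues = (g @` setT)%classic.
  apply/seteqP; split=> [x xP | _ [x _ <-] i]; last first.
    (* The modulus [d i] may be negative; the remainder depends only on its absolute value. *)
    by rewrite ffunE -modz_abs modz_small // ltz_nat ltn_ord.
  have x_ge0 i : 0 <= x i by rewrite -xP modz_ge0.
  have ltxd i : (absz (x i) < absz (d i))%N.
    by rewrite -ltz_nat gez0_abs // -{1}xP abszE ltz_mod.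
  exists [ffun i => Ordinal (ltxd i)] => //.
  by apply/ffunP=> i; rewrite !ffunE /= gez0_abs.
rewrite -cardT; apply: card_eq_trans (card_eq_setT_ord T).
apply: inj_card_eq => x y _ _ /ffunP eqg; apply/ffunP=> i.
by have := eqg i; rewrite !ffunE => -[/val_inj].
Qed.

Lemma card_residues_infinite i0 : d i0 = 0 -> residues #= [set: nat]%classic.
Proof.
move=> d0; apply: eq_card_nat; first exact: countableP.
(* Countability being settled, it suffices to embed the naturals: they are placed on the
   unconstrained axis [i0], with 0, a residue for every modulus, elsewhere. *)
apply/infiniteP; pose g (k : nat) : {ffun 'I_n -> int} :=
  [ffun i => if i == i0 then Posz k else 0].
have : (g @` setT)%classic #= [set: nat]%classic.
  apply: inj_card_eq => j k _ _ /ffunP /(_ i0).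
  by rewrite !ffunE eqxx => -[].
rewrite card_eq_le => /andP[_ /card_le_trans]; apply.
apply: subset_card_le => _ [k _ <-] i.
by rewrite ffunE; case: eqP => [->|_]; rewrite ?d0 ?modz0 ?mod0z.
Qed.

Lemma card_residues : residues #=
  if \prod_i d i == 0 then [set: nat]%classic else `I_(absz (\prod_i d i)%R).
Proof.
case: ifPn => [/prodf_eq0[i _ /eqP] | /prodf_neq0 nz]; last first.
  by rewrite absz_prod; apply: card_residues_finite => i; apply: nz.
exact: card_residues_infinite.
Qed.

End Residues.

(** * Cardinality of finitely presented abelian groups *)

Section PresentedGroups.
Variable X : finType.
Implicit Types (rels : seq {ffun X -> int}) (x y : {ffun X -> int}).

Lemma relspanP rels x :
  reflect (exists a : 'I_(size rels) -> int,
             x = \sum_(i < size rels) rels`_i *~ a i)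
          (x \in relspan rels).
Proof.
apply: (iffP (asboolP _)) => [[a ->]|[a ->]]; first by exists a.
by exists [ffun i => a i]; apply: eq_bigr => i _; rewrite ffunE.
Qed.

Lemma mem_relspan rels x : x \in rels -> x \in relspan rels.
Proof.
move=> xrels; have lti: (index x rels < size rels)%N by rewrite index_mem.
apply/relspanP; exists (fun i => (i == Ordinal lti)%:Z).
rewrite (bigD1 (Ordinal lti)) //= eqxx big1 ?addr0 ?nth_index //.
by move=> i /negPf->.
Qed.

(** The map [f] need not be additive: this allows coordinatewise reduction modulo the Smith
    divisors, whose values are plain integer vectors. *)
Lemma card_presented_ab_fibers rels (U : Type) (f : {ffun X -> int} -> U) :
  (forall x y, f x = f y <-> x - y \in relspan rels) ->
  [set: presented_ab rels]%classic #= range f.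
Proof.
move=> fP; pose g (q : presented_ab rels) := f (repr q).
have gpi x : g (\pi_(presented_ab rels) x) = f x.
  by apply/fP; rewrite Quotient.idealrBE reprK.
have -> : range f = range g.
  apply/seteqP; split=> _ [x _ <-]; last by exists (repr x).
  by exists (\pi_(presented_ab rels) x).
rewrite card_eq_sym; apply: inj_card_eq => p q _ _ /fP.
by rewrite Quotient.idealrBE !reprK => /eqP.
Qed.

Lemma card_presented_ab_iso rels1 rels2
    (f g : {additive {ffun X -> int} -> {ffun X -> int}}) :
    cancel f g -> cancel g f ->
    (forall x, x \in rels1 -> f x \in relspan rels2) ->
    (forall x, x \in rels2 -> g x \in relspan rels1) ->
  [set: presented_ab rels1]%classic #= [set: presented_ab rels2]%classic.
Proof.
move=> fK gK f12 g21.
have imspan (h : {additive {ffun X -> int} -> {ffun X -> int}}) r1 r2 :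
    (forall x, x \in r1 -> h x \in relspan r2) ->
    forall x, x \in relspan r1 -> h x \in relspan r2.
  move=> h12 _ /relspanP[a ->]; rewrite raddf_sum; apply: rpred_sum => i _.
  by rewrite raddfMz; apply/rpredMz/h12/mem_nth.
(* Since membership of generators extends to spans, the fibres of the projection after [f] are
   exactly the cosets for [rels1]. *)
have -> : [set: presented_ab rels2]%classic =
    range (fun x => \pi_(presented_ab rels2) (f x)).
  apply/seteqP; split=> // q _; exists (g (repr q)) => //.
  by rewrite gK reprK.
apply: card_presented_ab_fibers => x y; split.
  move/eqP; rewrite -Quotient.idealrBE -raddfB => /(imspan g _ _ g21).
  by rewrite fK.
by move/(imspan f _ _ f12); rewrite raddfB Quotient.idealrBE => /eqP.
Qed.

(** The matrix is square whatever the length of [rels]: missing relators become zero rows and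
    surplus ones are dropped. *)
Definition relmx rels : 'M[int]_#|X| :=
  \matrix_(i, j) (rels`_i : {ffun X -> int}) (enum_val j).

(** In the Smith form [L D R], the unimodular [L] only recombines relators and [R] only changes
    coordinates. The group is thus a product of cyclic groups of orders given by the diagonal
    (infinite for 0), counted by [residues]. *)
Lemma card_presented_ab_det rels : size rels = #|X| ->
  [set: presented_ab rels]%classic #=
  if \det (relmx rels) == 0 then [set: nat]%classic
  else `I_(absz (\det (relmx rels))%R).
Proof.
move=> sz; have [L uL [R uR [d0 _ defM]]] := int_Smith_normal_form (relmx rels).
pose d (i : 'I_#|X|) := d0`_i; pose D := diag_mx (\row_i d i).
have {}defM : relmx rels = L *m D *m R.
  rewrite defM; congr (_ *m _ *m _); apply/matrixP=> i j; rewrite !mxE.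
  by case: eqP => [/val_inj->|]; rewrite ?eqxx //; case: eqP => // ->.
have detM : absz (\det (relmx rels)) = absz (\prod_i d i).
  rewrite defM !det_mulmx !abszM (absz_det_unitmx uL) (absz_det_unitmx uR)
    mul1n muln1 det_diag.
  by congr absz; apply: eq_bigr => i _; rewrite mxE.
rewrite -absz_eq0 detM absz_eq0; apply: card_eq_trans (card_residues d).
pose v x : 'rV[int]_#|X| := \row_j x (enum_val j).
have vD x y : v (x - y) = v x - v y by apply/rowP=> j; rewrite !mxE !ffunE.
(* Coordinates of [x] in the basis formed by the rows of [R], reduced modulo the diagonal
   entries. *)
pose f x : {ffun 'I_#|X| -> int} :=
  [ffun i => ((v x *m invmx R) ord0 i %% d i)%Z].
have -> : residues d = range f.
  apply/seteqP; split=> [z zP|_ [x _ <-] i]; last by rewrite ffunE modz_mod.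
  exists [ffun a => ((\row_i z i) *m R) ord0 (enum_rank a)] => //.
  apply/ffunP=> i; rewrite ffunE -zP; congr (modz _ _).
  have -> : v [ffun a => ((\row_i z i) *m R) ord0 (enum_rank a)] =
            (\row_i z i) *m R.
    by apply/rowP=> j; rewrite mxE ffunE enum_valK.
  by rewrite mulmxK // mxE.
apply: card_presented_ab_fibers => x y.
have spanM : x - y \in relspan rels <-> exists a, v (x - y) = a *m relmx rels.
  have comb (a : 'I_(size rels) -> int) :
    v (\sum_(i < size rels) rels`_i *~ a i) =
    (\row_i a (cast_ord (esym sz) i)) *m relmx rels.
    apply/rowP=> j; rewrite !mxE sum_ffunE.
    rewrite (reindex (cast_ord sz)) /=; last first.
      by exists (cast_ord (esym sz)) => i _; rewrite ?cast_ordK ?cast_ordKV.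
    apply: eq_bigr => i _; rewrite !mxE cast_ordK ffunMzE.
    by rewrite mulrzz mulrC.
  split=> [/relspanP[a ->]|[a eqa]]; first by rewrite comb; eexists.
  apply/relspanP; exists (fun i => a ord0 (cast_ord sz i)).
  have : v (x - y) = v (\sum_(i < size rels) rels`_i *~ a ord0 (cast_ord sz i)).
    rewrite comb eqa; congr (_ *m _); apply/rowP=> i; rewrite mxE.
    by rewrite cast_ordKV.
  move/rowP=> eqv; apply/ffunP=> b.
  by have := eqv (enum_rank b); rewrite !mxE enum_rankK.
rewrite spanM; split=> [/ffunP eqf | [a]].
  have dvd i : (d i %| (v (x - y) *m invmx R) ord0 i)%Z.
    rewrite vD mulmxBl !mxE -eqz_mod_dvd; apply/eqP.
    by have := eqf i; rewrite !ffunE !mxE.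
  (* The exact quotient by [D] satisfies [q D R = v (x - y)], hence the coefficients over the
     relators are [q] times the inverse of [L]. *)
  pose q : 'rV_#|X| := \row_i (((v (x - y) *m invmx R) ord0 i) %/ d i)%Z.
  exists (q *m invmx L); rewrite defM mulmxA mulmxA mulmxKV //.
  apply: (canRL (mulmxKV uR)); apply/rowP=> i.
  by rewrite mul_mx_diag; have := divzK (dvd i); rewrite !mxE => ->.
rewrite defM vD => /(congr1 (mulmx^~ (invmx R))) /=.
rewrite !mulmxA mulmxK // mulmxBl => /rowP eqa; apply/ffunP=> i.
have := eqa i; rewrite mul_mx_diag !mxE !ffunE => eqai.
by apply/eqP; rewrite eqz_mod_dvd !mxE eqai dvdz_mull.
Qed.

(** The determinant of the Gram matrix is the square of that of [relmx], so it fixes the absolute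
    value of the latter, and this decides the cardinality in the finite and the infinite case
    alike. *)
Lemma card_presented_ab_gram rels1 rels2 :
    size rels1 = #|X| -> size rels2 = #|X| ->
    (forall i j : X,
       \sum_(x <- rels1) x i * x j = \sum_(x <- rels2) x i * x j) ->
  [set: presented_ab rels1]%classic #= [set: presented_ab rels2]%classic.
Proof.
move=> sz1 sz2 gram.
have gramE rels : size rels = #|X| ->
    (relmx rels)^T *m relmx rels =
    \matrix_(i, j) \sum_(x <- rels) x (enum_val i) * x (enum_val j).
  move=> sz; apply/matrixP=> i j; rewrite !mxE (big_nth 0) big_mkord sz.
  by apply: eq_bigr => k _; rewrite !mxE.
have eqdet : absz (\det (relmx rels1)) = absz (\det (relmx rels2)).
  apply/eqP; rewrite -eqn_sqr -!abszX; apply/eqP; congr absz.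
  rewrite !expr2 -{1}(det_tr (relmx rels1)) -{1}(det_tr (relmx rels2)).
  rewrite -!det_mulmx !gramE //.
  by congr (\det _); apply/matrixP=> i j; rewrite !mxE.
have := card_presented_ab_det sz2; have := card_presented_ab_det sz1.
rewrite -!(absz_eq0 (\det _)) eqdet => c1 c2.
by apply: card_eq_trans c1 _; rewrite card_eq_sym.
Qed.

End PresentedGroups.

(** * Transvections along two vectors *)

Section Transvection.
Variables (V : zmodType) (al be : {additive V -> int}).

Definition transvect (u v x : V) : V := x + u *~ al x + v *~ be x.

Lemma transvect_zmod_morphism u v : zmod_morphism (transvect u v).
Proof.
move=> x y; rewrite /transvect (raddfB al) (raddfB be) !mulrzBr.
by rewrite !opprD [RHS]addrACA [in RHS](addrACA x).
Qed.

HB.instance Definition _ u v :=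
  GRing.isZmodMorphism.Build V V (transvect u v) (transvect_zmod_morphism u v).

(** As both functionals kill [u] and [v], the map preserves [al x] and [be x], so the same multiples
    are subtracted again. *)
Lemma transvectK u v : al u = 0 -> be u = 0 -> al v = 0 -> be v = 0 ->
  cancel (transvect u v) (transvect (- u) (- v)).
Proof.
move=> alu beu alv bev x; rewrite /transvect !raddfD /= !raddfMz /=.
rewrite alu beu alv bev !mul0rz !addr0 !mulNrz.
by rewrite [X in X - _]addrAC !addrK.
Qed.

End Transvection.

Lemma sum_sig_eq (T : finType) (A : {set T}) x : x \in A ->
  \sum_(y : {y | y \in A}) (val y == x)%:Z = 1.
Proof.
move=> Ax; rewrite (bigD1 (exist _ x Ax)) //= eqxx big1 ?addr0 // => y.
by rewrite -val_eqE => /negPf /= ->.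
Qed.

(** * Weights and change of base point *)

Section Bitrade.
Variables (R C S : finType) (W B : {set R * C * S}).
Implicit Types (T : {set R * C * S}) (t : R * C * S).
Notation V := {ffun indet W B -> int}.

(** Rows (below: columns) weigh 1 and symbols -1, so that both functionals vanish on every
    [r + c + s]. *)
Definition row_sym_weight (x : V) : int :=
  \sum_r x (inl (inl r)) - \sum_s x (inr s).
Definition col_sym_weight (x : V) : int :=
  \sum_c x (inl (inr c)) - \sum_s x (inr s).

Lemma row_sym_weight_zmod_morphism : zmod_morphism row_sym_weight.
Proof.
move=> x y; rewrite /row_sym_weight.
under eq_bigr do rewrite !ffunE.
under [in X in _ - X = _]eq_bigr do rewrite !ffunE.
by rewrite !sumrB opprD opprK addrACA opprD opprK.
Qed.

Lemma col_sym_weight_zmod_morphism : zmod_morphism col_sym_weight.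
Proof.
move=> x y; rewrite /col_sym_weight.
under eq_bigr do rewrite !ffunE.
under [in X in _ - X = _]eq_bigr do rewrite !ffunE.
by rewrite !sumrB opprD opprK addrACA opprD opprK.
Qed.

HB.instance Definition _ := GRing.isZmodMorphism.Build V int
  row_sym_weight row_sym_weight_zmod_morphism.
HB.instance Definition _ := GRing.isZmodMorphism.Build V int
  col_sym_weight col_sym_weight_zmod_morphism.

Lemma weight_row_gen r : r \in rows W B ->
  (row_sym_weight (row_gen W B r) = 1) * (col_sym_weight (row_gen W B r) = 0).
Proof.
move=> rP; rewrite /row_sym_weight /col_sym_weight.
split; last by rewrite !big1 ?subr0 // => i _; rewrite ffunE.
under eq_bigr do rewrite ffunE.
by rewrite sum_sig_eq // big1 ?subr0 // => i _; rewrite ffunE.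
Qed.

Lemma weight_col_gen c : c \in cols W B ->
  (row_sym_weight (col_gen W B c) = 0) * (col_sym_weight (col_gen W B c) = 1).
Proof.
move=> cP; rewrite /row_sym_weight /col_sym_weight.
split; first by rewrite !big1 ?subr0 // => i _; rewrite ffunE.
under eq_bigr do rewrite ffunE.
by rewrite sum_sig_eq // big1 ?subr0 // => i _; rewrite ffunE.
Qed.

Lemma weight_sym_gen s : s \in syms W B ->
  (row_sym_weight (sym_gen W B s) = -1) * (col_sym_weight (sym_gen W B s) = -1).
Proof.
move=> sP; rewrite /row_sym_weight /col_sym_weight.
by split; under [in X in _ - X]eq_bigr do rewrite ffunE;
  rewrite sum_sig_eq // big1 ?sub0r // => i _; rewrite ffunE.
Qed.

Lemma mem_rcs T t : T \subset W :|: B -> t \in T ->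
  [/\ row_of t \in rows W B, col_of t \in cols W B & sym_of t \in syms W B].
Proof. by move=> /fintype.subsetP sT /sT tT; rewrite !imset_f. Qed.

(* The transvection along [r1 - r0] and [c1 - c0] fixes every relator of a
   triple, since the two weights vanish there, and moves the base point. *)
Lemma card_base_change T t r1 c1 : T \subset W :|: B -> t \in T ->
    r1 \in rows W B -> c1 \in cols W B ->
  [set: presented_ab (triple_relators W B T ++ base_relators W B t)]%classic #=
  [set: presented_ab (triple_relators W B T ++
                      [:: row_gen W B r1; col_gen W B c1])]%classic.
Proof.
move=> sT tT r1P c1P; have [r0P c0P s0P] := mem_rcs sT tT.
pose u := row_gen W B r1 - row_gen W B (row_of t).
pose v := col_gen W B c1 - col_gen W B (col_of t).
have wE := (weight_row_gen r0P, weight_row_gen r1P, weight_col_gen c0P,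
            weight_col_gen c1P, weight_sym_gen s0P).
have ru : row_sym_weight u = 0 by rewrite raddfB /= !wE.
have cu : col_sym_weight u = 0 by rewrite raddfB /= !wE.
have rv : row_sym_weight v = 0 by rewrite raddfB /= !wE.
have cv : col_sym_weight v = 0 by rewrite raddfB /= !wE.
have fix_triple a b x : x \in triple_relators W B T ->
    transvect row_sym_weight col_sym_weight a b x = x.
  case/mapP=> t'; rewrite mem_enum => t'T ->.
  have [rP cP sP] := mem_rcs sT t'T.
  have w't := (weight_row_gen rP, weight_col_gen cP, weight_sym_gen sP).
  set y := _ + sym_gen _ _ _; rewrite /transvect /=.
  have -> : row_sym_weight y = 0 by rewrite !raddfD /= !w't.
  have -> : col_sym_weight y = 0 by rewrite !raddfD /= !w't.
  by rewrite !mulr0z !addr0.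
apply: (@card_presented_ab_iso _ _ _
  (transvect row_sym_weight col_sym_weight u v)
  (transvect row_sym_weight col_sym_weight (- u) (- v))).
- exact: transvectK.
- have := @transvectK _ row_sym_weight col_sym_weight (- u) (- v).
  by rewrite !opprK; apply; rewrite raddfN /= ?(ru, cu, rv, cv) oppr0.
- set rels2 := _ ++ [:: _; _].
  have r1in : row_gen W B r1 \in relspan rels2.
    by apply: mem_relspan; rewrite mem_cat !inE eqxx orbT.
  have c1in : col_gen W B c1 \in relspan rels2.
    by apply: mem_relspan; rewrite mem_cat !inE eqxx !orbT.
  move=> x; rewrite mem_cat => /orP[xT|xb].
    by rewrite /= fix_triple //; apply: mem_relspan; rewrite mem_cat xT.
  (* The row and column generators of [t] go to those of [r1] and [c1]; its symbol generator loses
     [u + v], which leaves the relator of [t] minus the two new base generators. *)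
  rewrite !inE in xb; case/or3P: xb => /eqP->; rewrite /= /transvect /= !wE.
  + by rewrite mulr1z mulr0z addr0 addrC subrK.
  + by rewrite mulr1z mulr0z addr0 addrC subrK.
  have -> : sym_gen W B (sym_of t) + u *~ (-1) + v *~ (-1) =
      (row_gen W B (row_of t) + col_gen W B (col_of t) + sym_gen W B (sym_of t))
      - row_gen W B r1 - col_gen W B c1.
    by apply/ffunP=> z; rewrite !mulrNz !mulr1z !ffunE; lia.
  rewrite !rpredB //; apply: mem_relspan; rewrite mem_cat; apply/orP; left.
  by apply/mapP; exists t; rewrite ?mem_enum.
set rels1 := _ ++ base_relators _ _ _.
move=> x; rewrite mem_cat => /orP[xT|xb].
  by rewrite /= fix_triple //; apply: mem_relspan; rewrite mem_cat xT.
rewrite !inE in xb; case/orP: xb => /eqP->;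
  rewrite /= /transvect /= !wE mulr1z mulr0z addr0.
  rewrite opprB addrC subrK; apply: mem_relspan.
  by rewrite mem_cat !inE eqxx !orbT.
rewrite opprB addrC subrK; apply: mem_relspan.
by rewrite mem_cat !inE eqxx !orbT.
Qed.

(** * Gram matrices of the two halves of a bitrade *)

Section Mates.
Hypothesis bitradeWB : latin_bitrade W B.

(** Meant for [p] keeping two coordinates: the mates give [W] and [B] the same image, and partial
    latinity makes [p] injective on each, so both sums run over that common image. *)
Lemma sum_bitrade (Q : finType) (p : R * C * S -> Q) (F : Q -> int) :
    (forall T, partial_latin T -> {in T &, injective p}) ->
    (forall T T', has_mates T T' -> p @: T \subset p @: T') ->
  \sum_(t in W) F (p t) = \sum_(t in B) F (p t).
Proof.
case: bitradeWB => _ plW plB mWB mBW injp subp.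
have eq_im : p @: W = p @: B.
  by apply/eqP; rewrite finset.eqEsubset !subp.
rewrite -(big_imset F (injp _ plW)) -(big_imset F (injp _ plB)).
by rewrite eq_im.
Qed.

Lemma sum_row_col (F : R * C -> int) :
  \sum_(t in W) F (row_of t, col_of t) = \sum_(t in B) F (row_of t, col_of t).
Proof.
apply: (sum_bitrade (p := fun t => (row_of t, col_of t))) => [T plT|T T' mT].
  move=> t u tT uT [eqr eqc]; apply: contrapT => /(plT _ _ tT uT).
  by rewrite eqr eqc !eqxx.
apply/fintype.subsetP=> _ /imsetP[[[r c] s] /mT[_ _ [s' [[_ mate] _]]] ->].
by apply/imsetP; exists (r, c, s').
Qed.

Lemma sum_row_sym (F : R * S -> int) :
  \sum_(t in W) F (row_of t, sym_of t) = \sum_(t in B) F (row_of t, sym_of t).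
Proof.
apply: (sum_bitrade (p := fun t => (row_of t, sym_of t))) => [T plT|T T' mT].
  move=> t u tT uT [eqr eqs]; apply: contrapT => /(plT _ _ tT uT).
  by rewrite eqr eqs !eqxx; case: eqP.
apply/fintype.subsetP=> _ /imsetP[[[r c] s] /mT[_ [c' [[_ mate] _]] _] ->].
by apply/imsetP; exists (r, c', s).
Qed.

Lemma sum_col_sym (F : C * S -> int) :
  \sum_(t in W) F (col_of t, sym_of t) = \sum_(t in B) F (col_of t, sym_of t).
Proof.
apply: (sum_bitrade (p := fun t => (col_of t, sym_of t))) => [T plT|T T' mT].
  move=> t u tT uT [eqc eqs]; apply: contrapT => /(plT _ _ tT uT).
  by rewrite eqc eqs !eqxx; case: eqP.
apply/fintype.subsetP=> _ /imsetP[[[r c] s] /mT[[r' [[_ mate] _]] _ _] ->].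
by apply/imsetP; exists (r', c, s).
Qed.

Lemma card_bitrade : #|W| = #|B|.
Proof.
have := sum_row_col (fun=> 1); rewrite !sumr_const !natz.
by case.
Qed.

(* An entry of the Gram matrix only depends on how many triples contain a given
   pair of indeterminates, and the mates preserve that number. *)
Lemma gram_triple_relators (i j : indet W B) :
  \sum_(x <- triple_relators W B W) x i * x j =
  \sum_(x <- triple_relators W B B) x i * x j.
Proof.
rewrite !big_map !big_enum /=.
pose g t : V := row_gen W B (row_of t) + col_gen W B (col_of t)
                + sym_gen W B (sym_of t).
have gr r t : g t (inl (inl r)) = (val r == row_of t)%:Z.
  by rewrite !ffunE !addr0.
have gc c t : g t (inl (inr c)) = (val c == col_of t)%:Z.
  by rewrite !ffunE addr0 add0r.
have gs s t : g t (inr s) = (val s == sym_of t)%:Z.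
  by rewrite !ffunE !add0r.
rewrite -/(\sum_(t in W) g t i * g t j = \sum_(t in B) g t i * g t j).
have sumE T T' (F G : R * C * S -> int) : F =1 G ->
    \sum_(t in T) G t = \sum_(t in T') G t ->
    \sum_(t in T) F t = \sum_(t in T') F t.
  by move=> eqFG; do 2![rewrite (eq_bigr _ (fun t _ => eqFG t))].
case: i => [[i|i]|i]; case: j => [[j|j]|j];
  (apply: sumE => [t|]; first by rewrite !(gr, gc, gs)).
(* Two indeterminates of the same kind involve a single coordinate; any pair projection that keeps
   it serves. *)
- exact: (sum_row_col (fun q => (val i == q.1)%:Z * (val j == q.1)%:Z)).
- exact: (sum_row_col (fun q => (val i == q.1)%:Z * (val j == q.2)%:Z)).
- exact: (sum_row_sym (fun q => (val i == q.1)%:Z * (val j == q.2)%:Z)).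
- exact: (sum_row_col (fun q => (val i == q.2)%:Z * (val j == q.1)%:Z)).
- exact: (sum_row_col (fun q => (val i == q.2)%:Z * (val j == q.2)%:Z)).
- exact: (sum_col_sym (fun q => (val i == q.1)%:Z * (val j == q.2)%:Z)).
- exact: (sum_row_sym (fun q => (val i == q.2)%:Z * (val j == q.1)%:Z)).
- exact: (sum_col_sym (fun q => (val i == q.2)%:Z * (val j == q.1)%:Z)).
- exact: (sum_col_sym (fun q => (val i == q.2)%:Z * (val j == q.2)%:Z)).
Qed.

End Mates.

Lemma card_indet : #|indet W B| = (#|rows W B| + #|cols W B| + #|syms W B|)%N.
Proof. by rewrite !card_sum !card_sig. Qed.

End Bitrade.

(** * Comparison of the two groups *)

Theorem theorem5p5 (R C S : finType) (W B : {set R * C * S})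
    (r0 r1 : R) (c0 c1 : C) (s0 s1 : S) :
  spherical_bitrade W B ->
  (r0, c0, s0) \in W ->
  (r1, c1, s1) \in B ->
  (@classical_sets.setT (Astar W B (r0, c0, s0)))
    #= (@classical_sets.setT (Bstar W B (r1, c1, s1))).
Proof.
case=> bitradeWB _ _ euler Wt0 Bt1.
have [r1P c1P _] := mem_rcs (finset.subsetUr W B) Bt1.
have sz (T : {set R * C * S}) : #|T| = #|W| ->
    size (triple_relators W B T ++ [:: row_gen W B r1; col_gen W B c1])
    = #|indet W B|.
  (* The 2 in Euler's formula accounts for the two base relators. *)
  move=> eqT; rewrite size_cat size_map -cardE eqT card_indet.
  by rewrite /=; move: #|W| #|rows W B| #|cols W B| #|syms W B| euler; lia.
(* Both groups are moved to the same base [r1], [c1], so that the presentations differ only in their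
   triple relators. *)
apply: card_eq_trans (card_base_change (finset.subsetUl W B) Wt0 r1P c1P) _.
rewrite card_eq_sym.
apply: card_eq_trans (card_base_change (finset.subsetUr W B) Bt1 r1P c1P) _.
apply: card_presented_ab_gram => [||i j].
- by apply: sz; rewrite (card_bitrade bitradeWB).
- exact: sz.
by rewrite !big_cat /= (gram_triple_relators bitradeWB).
Qed.
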